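(* If $K$ is a countable compact subset of $\mathbb C$, then $\overline P=B(K)=C(K)^{\mathbb N_0}$, where $P$ denotes the set of polynomials and its closure is taken in the topology of $B(K)$.
   Context: $\mathbb N_0=\{0,1,2,\dots\}$, and $C(K)$ is the set of continuous functions $K\to\mathbb C$. For a compact $K\subset\mathbb C$, $A(K)$ is the set of functions $f:K\to\mathbb C$ continuous on $K$ and holomorphic in the interior of $K$ (so $A(K)=C(K)$ if the interior is empty). $O(K)$ is the set of functions $f$ holomorphic on some open set $V_f\supseteq K$ (depending on $f$), with the metric $$d(f,g)=\sum_{k=0}^\infty \frac1{2^k}\,\frac{\sup_{z\in K}|f^{(k)}(z)-g^{(k)}(z)|}{1+\sup_{z\in K}|f^{(k)}(z)-g^{(k)}(z)|},$$ where functions agreeing near $K$ are identified. A function $f\in O(K)$ is identified with the sequence $(f^{(k)}|_K)_{k\ge0}\in A(K)^{\mathbb N_0}$. $B(K)$ is the completion of $(O(K),d)$, realized as the set of sequences $(g_k)_{k\ge0}\in A(K)^{\mathbb N_0}$ for which there exist $f_n\in O(K)$ with $\sup_{z\in K}|f_n^{(k)}(z)-g_k(z)|\to0$ as $n\to\infty$ for every $k\in\mathbb N_0$; its metric is given by the same formula $d$ with $f^{(k)},g^{(k)}$ replaced by the $k$-th terms of the sequences (so convergence is uniform convergence on $K$ of each term). Polynomials are regarded as elements of $O(K)\subset B(K)$. *)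

(* Defs.v *)
From HB Require Import structures.
From mathcomp Require Import all_boot all_order all_algebra.
From mathcomp Require Import all_classical all_reals all_analysis.
From mathcomp.real_closed Require Import complex.
From mathcomp Require Import ring.

Set Implicit Arguments.
Unset Strict Implicit.
Unset Printing Implicit Defensive.

Import Order.TTheory GRing.Theory Num.Theory.
Import numFieldNormedType.Exports ComplexField.Normc.

Local Open Scope classical_set_scope.
Local Open Scope ring_scope.
Local Open Scope complex_scope.

(* R[i] gets the topology of its norm and is a normed space over itself, so that
   [derivable] and the derivatives below are complex ones. *)
HB.instance Definition _ (R : rcfType) := NormedModule.copy R[i] R[i]^o.

Definition holomorphic_on (R : realType) (V : set R[i]) (f : R[i] -> R[i]) :
    Prop :=
  forall z, V z -> derivable f z 1.

Section spaces.
Context {R : realType} (K : set R[i]).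

Definition CK : set (K -> R[i]) := [set f | continuous f].

(* A function on K has no derivative in the library's sense; at an interior
   point of K the derivative of an extension F does not depend on F. *)
Definition AK : set (K -> R[i]) :=
  [set f | continuous f /\
     exists2 F : R[i] -> R[i], sigL K F = f & holomorphic_on K^° F].

(* The values of f outside of the open set V are irrelevant. *)
Definition OK : set (R[i] -> R[i]) :=
  [set f | exists V, [/\ open V, K `<=` V & holomorphic_on V f]].

Definition jet (f : R[i] -> R[i]) : nat -> K -> R[i] :=
  fun k => sigL K (f^`(k)%classic).

(* This is 0 if K is empty. *)
Definition supdist (f g : K -> R[i]) : R :=
  sup (range (fun z : K => normc (f z - g z))).

Definition BK : set (nat -> K -> R[i]) :=
  [set g | (forall k, AK (g k)) /\
     exists2 f : nat -> R[i] -> R[i], forall n, OK (f n) &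
       forall k, (fun n => supdist (jet (f n) k) (g k)) @ \oo --> (0 : R)].

Definition BKdist (g h : nat -> K -> R[i]) : R :=
  limn (fun n => \sum_(0 <= k < n)
    1 / 2 ^+ k * (supdist (g k) (h k) / (1 + supdist (g k) (h k)))).

End spaces.

Arguments CK {R} K _.
Arguments AK {R} K _.
Arguments OK {R} K _.
Arguments jet {R} K f _ _.
Arguments BK {R} K _.

(* B(K) as a type. Compactness of K makes the suprema finite, hence [BKdist] a
   metric. *)
Definition Bspace (R : realType) (K : set R[i]) (cK : compact K) : Type :=
  set_type (BK K).

Section metric.
Context {R : realType} (K : set R[i]).
Implicit Types f g h : K -> R[i].

Lemma normc_dist (x y : R[i]) : `|normc x - normc y| <= normc (x - y).
Proof.
rewrite ler_norml lerNl opprB !lerBlDr; apply/andP; split.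
  by rewrite -(normcN (x - y)) opprB (le_trans _ (le_normcD _ _))// subrK.
by rewrite (le_trans _ (le_normcD _ _))// subrK.
Qed.

Lemma normc_continuous : continuous (@normc R : R[i] -> R).
Proof.
move=> x; apply/(@cvgrPdist_lt _ _ _ (nbhs x)) => e e0.
have e0' : 0 < e%:C by rewrite ltcR.
have xe : nbhs x (ball x e%:C) by exact: nbhsx_ballx.
apply: filterS xe => y; rewrite -ball_normE/= => xy.
by apply: le_lt_trans (normc_dist _ _) _; rewrite -ltcR.
Qed.

Lemma CK_has_ubound (cK : compact K) f g : CK K f -> CK K g ->
  has_ubound (range (fun z : K => normc (f z - g z))).
Proof.
move=> cf cg.
pose F := valL_ (0 : R[i]) f; pose G := valL_ (0 : R[i]) g.
have sF : sigL K F = f by exact: valLK.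
have sG : sigL K G = g by exact: valLK.
have cF : {within K, continuous F}.
  by rewrite -sF in cf; exact/(@subspace_sigL_continuousP R[i] K R[i] F).
have cG : {within K, continuous G}.
  by rewrite -sG in cg; exact/(@subspace_sigL_continuousP R[i] K R[i] G).
have cN : {within K, continuous (fun z => normc (F z - G z))}.
  move=> z; apply: (@continuous_comp (subspace K) R[i] R (fun z => F z - G z)).
    by apply: continuousB; [exact: cF|exact: cG].
  exact: normc_continuous.
have /compact_bounded[M [_ HM]] := continuous_compact cN cK.
exists (M + 1) => _ [z _ <-].
have -> : normc (f z - g z) = normc (F (\val z) - G (\val z)).
  by rewrite -sF -sG.
apply: le_trans (ler_norm _) _; apply: HM; first by rewrite ltrDl.
by exists (\val z) => //; apply: set_valP.
Qed.

Lemma normc_ge0 (x : R[i]) : 0 <= normc x.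
Proof. by case: x => a b; rewrite /normc sqrtr_ge0. Qed.

Lemma supdist_ge0 f g : 0 <= supdist f g.
Proof.
rewrite /supdist; set E := (X in sup X).
have [hE|hE] := pselect (has_sup E); last by rewrite sup_out.
have [_ [z _ _]] := hE.1.
apply: (@le_trans _ _ (normc (f z - g z))); first exact: normc_ge0.
by apply: sup_upper_bound => //; exists z.
Qed.

Lemma supdist_sym f g : supdist f g = supdist g f.
Proof.
rewrite /supdist (_ : (fun z => _) = fun z => normc (g z - f z))//.
by apply/funext => z; rewrite -normcN opprB.
Qed.

Lemma supdistxx f : supdist f f = 0.
Proof.
rewrite /supdist; set E := (X in sup X).
have [hE|hE] := pselect (has_sup E); last by rewrite sup_out.
have [_ [z _ _]] := hE.1.
rewrite (_ : E = [set 0]) ?sup1//.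
apply/seteqP; split => [_ [t _ <-]|_ ->] /=; first by rewrite subrr normc0.
by exists z => //; rewrite subrr normc0.
Qed.

Lemma le_supdist (cK : compact K) f g (z : K) : CK K f -> CK K g ->
  normc (f z - g z) <= supdist f g.
Proof. by move=> cf cg; apply: ub_le_sup; [exact: CK_has_ubound|exists z]. Qed.

Lemma supdist_triangle (cK : compact K) g f h : CK K f -> CK K g -> CK K h ->
  supdist f h <= supdist f g + supdist g h.
Proof.
move=> cf cg ch; have s0 : 0 <= supdist f g + supdist g h.
  by rewrite addr_ge0// supdist_ge0.
rewrite {1}/supdist; set E := (X in sup X).
have [hE|hE] := pselect (has_sup E); last by rewrite sup_out.
apply: ge_sup; first exact: hE.1.
move=> _ [z _ <-]; rewrite -(subrK (g z) (f z)) -addrA.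
by apply: le_trans (le_normcD _ _) _; rewrite lerD// le_supdist.
Qed.

Definition BKterm (g h : nat -> K -> R[i]) (k : nat) : R :=
  1 / 2 ^+ k * (supdist (g k) (h k) / (1 + supdist (g k) (h k))).

Lemma BKterm_ge0 (g h : nat -> K -> R[i]) k : 0 <= BKterm g h k.
Proof.
have s0 := supdist_ge0 (g k) (h k).
by rewrite mulr_ge0// divr_ge0// ?exprn_ge0// addr_ge0.
Qed.

Lemma BKterm_cvg (g h : nat -> K -> R[i]) : cvgn (series (BKterm g h)).
Proof.
apply: (@series_le_cvg _ _ (geometric 1 2^-1)).
- exact: BKterm_ge0.
- by move=> n; rewrite mulr_ge0// exprn_ge0// invr_ge0.
- move=> k; have s0 := supdist_ge0 (g k) (h k).
  rewrite /BKterm /geometric/= exprVn ler_piMr// ?divr_ge0 ?exprn_ge0//.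
  by rewrite ler_pdivrMr ?mul1r ?lerDr// ltr_wpDr.
- by apply: is_cvg_geometric_series; rewrite ger0_norm ?invr_ge0// invf_lt1// ltr1n.
Qed.

Lemma BKdistE (g h : nat -> K -> R[i]) : BKdist g h = limn (series (BKterm g h)).
Proof. by []. Qed.

Lemma BKdistxx (g : nat -> K -> R[i]) : BKdist g g = 0.
Proof.
rewrite BKdistE (_ : series _ = cst 0) ?lim_cst//; apply/funext => n.
by rewrite /series/= big1// => k _; rewrite /BKterm supdistxx mul0r mulr0.
Qed.

Lemma BKdist_sym (g h : nat -> K -> R[i]) : BKdist g h = BKdist h g.
Proof.
rewrite !BKdistE; congr (limn (series _)); apply/funext => k.
by rewrite /BKterm supdist_sym.
Qed.

Lemma BKdist_triangle (cK : compact K) (y x z : nat -> K -> R[i]) :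
  (forall k, CK K (x k)) -> (forall k, CK K (y k)) -> (forall k, CK K (z k)) ->
  BKdist x z <= BKdist x y + BKdist y z.
Proof.
move=> cx cy cz.
rewrite !BKdistE -(lim_seriesD (@BKterm_cvg x y) (@BKterm_cvg y z)).
apply: lim_series_le; first exact: BKterm_cvg.
  by apply: is_cvg_seriesD; exact: BKterm_cvg.
move=> k; rewrite /BKterm /= -[X in _ <= X]/(_ + _) -mulrDr.
rewrite ler_wpM2l// ?divr_ge0 ?exprn_ge0//.
have := supdist_triangle cK (cx k) (cy k) (cz k).
move: (supdist_ge0 (x k) (y k)) (supdist_ge0 (y k) (z k)).
move: (supdist_ge0 (x k) (z k)).
move: (supdist _ _) (supdist _ _) (supdist _ _) => c b a a0 b0 c0 abc.
have E (t : R) : 0 <= t -> t / (1 + t) = 1 - (1 + t)^-1.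
  by move=> t0; field; rewrite gt_eqF// ltr_wpDr.
apply: (@le_trans _ _ ((b + c) / (1 + (b + c)))).
  rewrite !E ?addr_ge0// lerD2l lerN2 lef_pV2 ?posrE ?ltr_wpDr ?addr_ge0//.
  by rewrite lerD2l.
by rewrite mulrDl lerD// ler_wpM2l// lef_pV2 ?posrE ?ltr_wpDr ?addr_ge0//
  lerD2l ?lerDl ?lerDr.
Qed.

Lemma BKdist_eq0 (cK : compact K) (g h : nat -> K -> R[i]) :
  (forall k, CK K (g k)) -> (forall k, CK K (h k)) -> BKdist g h = 0 -> g = h.
Proof.
move=> cg ch gh0; apply/funext => k; apply/funext => z.
have : BKterm g h k <= 0.
  rewrite -gh0 BKdistE.
  have : series (BKterm g h) k.+1 <= limn (series (BKterm g h)).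
    apply: nondecreasing_cvgn_le; last exact: BKterm_cvg.
    by apply: nondecreasing_series => n _ _; exact: BKterm_ge0.
  apply: le_trans; rewrite seriesEnat/= big_nat_recr//= lerDr sumr_ge0// => n _.
  exact: BKterm_ge0.
have s0 := supdist_ge0 (g k) (h k).
rewrite /BKterm pmulr_rle0 ?divr_gt0 ?exprn_gt0//.
rewrite pmulr_lle0 ?invr_gt0 ?ltr_wpDr// => sle0.
apply/eqP; rewrite -subr_eq0; apply/eqP/eq0_normc/le_anti.
by rewrite normc_ge0 andbT (le_trans _ sle0)// le_supdist.
Qed.

Lemma BK_CK (g : nat -> K -> R[i]) : BK K g -> forall k, CK K (g k).
Proof. by move=> [Ag _] k; have [] := Ag k. Qed.

End metric.

HB.instance Definition _ (R : realType) (K : set R[i]) (cK : compact K) :=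
  Choice.copy (Bspace cK) (set_type (BK K)).

Section Bspace_metric.
Context {R : realType} (K : set R[i]) (cK : compact K).
Implicit Types g h : Bspace cK.

Definition Bspace_dist g h : R := BKdist (set_val g) (set_val h).

Let CKval g k : CK K (set_val g k).
Proof. by apply: BK_CK; exact: set_valP. Qed.

Lemma Bspace_distxx g : Bspace_dist g g = 0.
Proof. exact: BKdistxx. Qed.

Lemma Bspace_dist_eq0 g h : Bspace_dist g h = 0 -> g = h.
Proof. by move=> gh; apply: val_inj; apply: (BKdist_eq0 cK _ _ gh). Qed.

Lemma Bspace_dist_sym g h : Bspace_dist g h = Bspace_dist h g.
Proof. exact: BKdist_sym. Qed.

Lemma Bspace_dist_triangle h g (l : Bspace cK) :
  Bspace_dist g l <= Bspace_dist g h + Bspace_dist h l.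
Proof. exact: BKdist_triangle. Qed.

HB.instance Definition _ := @isMetric.Build R (Bspace cK) Bspace_dist
  Bspace_distxx Bspace_dist_eq0 Bspace_dist_sym Bspace_dist_triangle.

End Bspace_metric.

Section polynomials.
Context {R : realType} (K : set R[i]).
Implicit Types p : {poly R[i]}.

Lemma is_derive_hornerC p (z : R[i]) :
  is_derive z (1 : R[i]) (horner p : R[i] -> R[i]) (p^`()%R).[z].
Proof.
elim/poly_ind: p => [|p c ih].
  rewrite (_ : horner 0 = cst 0); last by apply/funext => x; rewrite horner0.
  by rewrite deriv0 horner0; exact: is_derive_cst.
rewrite (_ : horner _ = (horner p * id + cst c :> (R[i] -> R[i]))); last first.
  by apply/funext => x; rewrite !hornerE.
have := is_deriveD (is_deriveM ih (is_derive_id z 1)) (is_derive_cst c z 1).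
move/is_derive_eq; apply.
rewrite derivD derivM derivX derivC !hornerE /GRing.scale/= mulr1.
by rewrite mulrC addrC.
Qed.

Lemma derive1n_horner p k :
  (horner p : R[i] -> R[i])^`(k)%classic = horner (p^`(k)%R).
Proof.
elim: k => [|k ih]; first by rewrite derivn0.
rewrite derive1nS ih derivnS; apply/funext => z; rewrite derive1E.
by have [_ ->] := is_derive_hornerC (p^`(k)%R) z.
Qed.

Lemma continuous_hornerC p : continuous (horner p : R[i] -> R[i]).
Proof.
move=> z; apply: differentiable_continuous; apply/derivable1_diffP.
by have [] := is_derive_hornerC p z.
Qed.

Lemma OK_horner p : OK K (horner p).
Proof.
exists setT; split => //; first exact: openT.
by move=> z _; have [] := is_derive_hornerC p z.
Qed.

Lemma BK_horner p : BK K (jet K (horner p)).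
Proof.
split=> [k|]; last first.
  exists (fun=> horner p) => [_|k]; first exact: OK_horner.
  by under eq_fun do rewrite supdistxx; exact: cvg_cst.
rewrite /jet derive1n_horner; split.
  apply/subspace_sigL_continuousP; apply: continuous_subspaceT.
  exact: continuous_hornerC.
exists (horner (p^`(k)%R)) => // z _.
by have [] := is_derive_hornerC (p^`(k)%R) z.
Qed.

Definition Bpoly (cK : compact K) p : Bspace cK :=
  exist _ (jet K (horner p)) (mem_set (BK_horner p)).

Definition Bpolys (cK : compact K) : set (Bspace cK) := range (Bpoly cK).

End polynomials.

Arguments Bpoly {R K} cK p.
Arguments Bpolys {R K} cK _.

(* Main.v *)
(** Given continuous g_0, ..., g_N on K, every point of K has a neighbourhood on
    which the jet of one polynomial (the Hermite interpolant at the point) is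
    close to (g_0, ..., g_N).  As K is countable, almost every line in a given
    direction avoids K, so K is cut by vertical and horizontal lines into small
    pieces that each have such a polynomial.

    Polynomials of different pieces are glued, uniformly on a neighbourhood of
    K of fixed radius, so that Cauchy's estimate controls the derivatives on K.
    The gluing uses a polynomial that is close to 1 on one side of the line and
    to 0 on the other: with the line as the imaginary axis, it approximates the
    rational function (w + 1)^n / ((w + 1)^n + (w - 1)^n), whose poles are on
    the line; the inverses of the linear factors w - it of the denominator are
    approximated by polynomials by moving t down from infinity (Runge's pole
    pushing).  Cauchy's estimate is only needed for polynomials, where the
    contour integral can be replaced by an average over roots of unity. *)
Require Import Defs.
From mathcomp Require Import all_boot all_order all_algebra.
From mathcomp Require Import all_classical all_reals all_analysis.
From mathcomp.real_closed Require Import complex.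
From mathcomp Require Import cyclic separable cyclotomic ring lra.

Set Implicit Arguments.
Unset Strict Implicit.
Unset Printing Implicit Defensive.

Import Order.TTheory GRing.Theory Num.Theory.
Import numFieldNormedType.Exports ComplexField.Normc.

Local Open Scope classical_set_scope.
Local Open Scope ring_scope.
Local Open Scope complex_scope.

(** * The modulus of complex numbers *)

Section complex_modulus.
Context {R : realType}.
Implicit Types w z : R[i].

Lemma normc_sqrtE z : normc z = Num.sqrt (complex.Re z ^+ 2 + complex.Im z ^+ 2).
Proof. by case: z. Qed.

Lemma normcX z n : normc (z ^+ n) = normc z ^+ n.
Proof.
elim: n => [|n ih]; first by rewrite !expr0 normc1.
by rewrite !exprS normcM ih.
Qed.

Lemma normc_real (x : R) : normc x%:C = `|x|.
Proof. by rewrite normc_sqrtE /= expr0n addr0 sqrtr_sqr. Qed.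

Lemma sqr_normcE z : normc z ^+ 2 = complex.Re z ^+ 2 + complex.Im z ^+ 2.
Proof. by rewrite normc_sqrtE sqr_sqrtr// addr_ge0// sqr_ge0. Qed.

Lemma ler_Re_normc z : `|complex.Re z| <= normc z.
Proof. by rewrite -lecR; exact: normc_ge_Re. Qed.

Lemma normc_i : normc 'i%C = 1 :> R.
Proof. by rewrite normc_sqrtE /= expr0n expr1n add0r sqrtr1. Qed.

Lemma ler_normc_ReIm z : normc z <= `|complex.Re z| + `|complex.Im z|.
Proof.
rewrite {1}[z]complexE; apply: le_trans (le_normcD _ _) _.
by rewrite normcM normc_i mul1r !normc_real.
Qed.

Lemma ler_normcB w z : normc (w - z) <= normc w + normc z.
Proof. by rewrite -(normcN z) le_normcD. Qed.

End complex_modulus.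

Lemma exists_expr_le (R : realType) (x e : R) : 0 <= x -> x < 1 -> 0 < e ->
  exists n, x ^+ n <= e.
Proof.
move=> x0 x1 e0.
have /cvgrPdist_le/(_ e e0)[n _ /(_ n (leqnn n))] : x ^+ n @[n --> \oo] --> 0.
  by apply: cvg_expr; rewrite ger0_norm.
by rewrite sub0r normrN normrX ger0_norm// => ?; exists n.
Qed.

(** * Approximate polynomial inverses off the imaginary axis *)

Section approximate_inverses.
Context {R : realType}.
Implicit Types (L : set R[i]) (a b : {poly R[i]}).

Definition approx_invertible L a := forall e : R, 0 < e ->
  exists b, forall w, L w -> normc (1 - a.[w] * b.[w]) <= e.

(** Neumann series: the powers of [1 - a * b] tend to 0 uniformly on [L], and each has the form
    [1 - a * b']. *)
Lemma approx_invertible_lt1 L a b (rho : R) : rho < 1 ->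
  (forall w, L w -> normc (1 - a.[w] * b.[w]) <= rho) -> approx_invertible L a.
Proof.
move=> rho1 ab e e0.
have [rho0|rho0] := ltP rho 0.
  exists b => w Lw; apply: le_trans (ab w Lw) _; lra.
have [n ne] := exists_expr_le rho0 rho1 e0.
have [b' b'E] : exists b', 1 - a * b' = (1 - a * b) ^+ n.
  elim: n {ne} => [|n [b' b'E]]; first by exists 0; rewrite mulr0 subr0 expr0.
  exists (b + b' - b * (a * b')); rewrite exprS -b'E; ring.
exists b' => w Lw; apply: le_trans ne.
have := congr1 (horner^~ w) b'E; rewrite !hornerE => ->.
by rewrite normcX lerXn2r ?nnegrE ?normc_ge0// ab.
Qed.

Lemma approx_invertibleC L (c : R[i]) : c != 0 -> approx_invertible L c%:P.
Proof.
move=> c0 e e0; exists (c^-1)%:P => w _.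
by rewrite !hornerC divff// subrr normc0 ltW.
Qed.

Lemma approx_invertibleM L a1 a2 : approx_invertible L a1 ->
  approx_invertible L a2 -> approx_invertible L (a1 * a2).
Proof.
move=> i1 i2 e e0.
(* As [|x| <= 1 + t <= 2], the product has error at most [t + 2t <= e]. *)
pose t := Num.min 1 e / 3.
have [t0 t1 te] : [/\ 0 < t, t <= 1 & 3 * t <= e].
  have m0 : 0 < Num.min 1 e by rewrite lt_min e0 ltr01.
  have : Num.min 1 e <= 1 by rewrite ge_min lexx.
  have : Num.min 1 e <= e by rewrite ge_min lexx orbT.
  by rewrite /t; split; lra.
have [b1 hb1] := i1 t t0; have [b2 hb2] := i2 t t0.
exists (b1 * b2) => w Lw; rewrite !hornerM.
set x := a1.[w] * b1.[w]; set y := a2.[w] * b2.[w].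
have -> : 1 - a1.[w] * a2.[w] * (b1.[w] * b2.[w]) = (1 - x) + (1 - (1 - x)) * (1 - y).
  rewrite /x /y; ring.
apply: le_trans (le_normcD _ _) _; rewrite normcM.
have X : normc (1 - x) <= t by exact: hb1.
have Y : normc (1 - y) <= t by exact: hb2.
have : normc (1 - (1 - x)) <= 2.
  apply: le_trans (ler_normcB _ _) _; rewrite normc1; lra.
have := normc_ge0 (1 - (1 - x)); have := normc_ge0 (1 - y).
nra.
Qed.

Lemma approx_invertible_prod L (I : Type) (s : seq I) (P : pred I)
    (F : I -> {poly R[i]}) :
  (forall i, P i -> approx_invertible L (F i)) ->
  approx_invertible L (\prod_(i <- s | P i) F i).
Proof.
move=> iF; apply: big_ind => //; last exact: approx_invertibleM.
by apply: approx_invertibleC; exact: oner_neq0.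
Qed.

Definition cut_disc (M d : R) : set R[i] :=
  [set w | normc w <= M /\ d <= `|complex.Re w|].

(* For t > 2M the inverse of w - it is given by a geometric series; an
   approximate inverse at it gives one at i(t - d/2), as |w - it| >= d. *)
Lemma approx_invertible_subi (M d t : R) : 0 < d -> 0 <= M ->
  approx_invertible (cut_disc M d) ('X - (t *i)%:P).
Proof.
move=> d0 M0.
(* Induction on the number of steps of length [d / 2] that bring [t] up to [2M + 1]. *)
suff claim (n : nat) : forall t, 2 * M + 1 <= t + n%:R * (d / 2) ->
    approx_invertible (cut_disc M d) ('X - (t *i)%:P).
  have [n hn] : exists n : nat, 2 * M + 1 - t <= n%:R * (d / 2).
    have d20 : 0 < d / 2 by lra.
    exists (Num.bound `|(2 * M + 1 - t) / (d / 2)|).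
    rewrite -ler_pdivrMr//; apply: le_trans (ler_norm _) _.
    by apply/ltW; apply: archi_boundP.
  by apply: (claim n); lra.
elim: n => [|n ih] {}t.
  rewrite mul0r addr0 => ht.
  have t0 : 0 < t by lra.
  apply: (@approx_invertible_lt1 _ _ (((- t *i)%R)^-1)%:P (1 / 2)); first lra.
  move=> w [wM _]; rewrite !hornerE.
  have ti0 : t *i != 0 :> R[i] by rewrite eq_complex /= eqxx/= gt_eqF.
  have -> : 1 - (w - t *i) * (- t *i)^-1 = w / t *i.
    by rewrite invrN; field.
  rewrite normcM normcV.
  have -> : normc (t *i) = t by rewrite normc_sqrtE /= expr0n add0r sqrtr_sqr gtr0_norm.
  by rewrite ler_pdivrMr//; lra.
move=> ht; have {ih}/ih ih : 2 * M + 1 <= t + d / 2 + n%:R * (d / 2).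
  by move: ht; rewrite -[n.+1%:R]natr1; lra.
have e0 : 0 < 1 / 4 :> R by lra.
have [b hb] := ih _ e0.
apply: (@approx_invertible_lt1 _ _ b (7 / 8)); first lra.
move=> w Lw; have := hb w Lw; rewrite !hornerE.
set e := 1 - (w - (t + d / 2)*i) * b.[w] => he.
(* Hence moving the pole down by [d / 2] costs at most [(d / 2) * 5 / (4d) = 5/8]; with the error
   1/4 this makes 7/8. *)
have bd : d * normc b.[w] <= 5 / 4.
  apply: (@le_trans _ _ (normc (1 - e))); last first.
    by apply: le_trans (ler_normcB _ _) _; rewrite normc1; lra.
  rewrite /e opprB addrC subrK normcM ler_wpM2r ?normc_ge0//.
  apply: le_trans (Lw.2) _; apply: le_trans (ler_Re_normc _).
  by case: (w) => x y; rewrite /= subr0.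
have -> : 1 - (w - t *i) * b.[w] = e - (d / 2)*i * b.[w].
  have tE : (t + d / 2)*i = t *i + (d / 2)*i :> R[i] by simpc.
  by rewrite /e tE; ring.
apply: le_trans (ler_normcB _ _) _; rewrite normcM.
have -> : normc ((d / 2)*i) = d / 2.
  by rewrite normc_sqrtE /= expr0n add0r sqrtr_sqr gtr0_norm// divr_gt0.
lra.
Qed.

End approximate_inverses.

(** * Polynomials close to 1 and 0 on the two sides of the imaginary axis *)

Section halfplane_separation.
Context {R : realType}.
Implicit Types (w z : R[i]) (M d : R).

Lemma Re0_complexi z : complex.Re z = 0 -> z = (complex.Im z) *i.
Proof. by case: z => x y /= ->. Qed.

Lemma sqr_normcD1 z : normc (z + 1) ^+ 2 = normc z ^+ 2 + 2 * complex.Re z + 1.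
Proof. by rewrite !sqr_normcE; case: z => x y /=; ring. Qed.

Lemma sqr_normcB1 z : normc (z - 1) ^+ 2 = normc z ^+ 2 - 2 * complex.Re z + 1.
Proof. by rewrite !sqr_normcE; case: z => x y /=; ring. Qed.

(* The roots z satisfy |z + 1| = |z - 1|, so they are purely imaginary. *)
Lemma approx_invertible_Cayley (n : nat) M d : (0 < n)%N -> 0 < d -> 0 <= M ->
  approx_invertible (cut_disc M d)
    (('X + 1) ^+ n + ('X - 1) ^+ n : {poly R[i]}).
Proof.
move=> n0 d0 M0; set D := _ + _.
have DE z : D.[z] = (z + 1) ^+ n + (z - 1) ^+ n.
  by rewrite /D !hornerE.
have D0 : D != 0.
  apply/eqP => D0; have := DE 1; rewrite D0 horner0 subrr expr0n gtn_eqF// addr0.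
  by move/eqP; rewrite eq_sym expf_eq0 n0/= (_ : 1 + 1 = 2%:R)// pnatr_eq0.
have [s Ds] := closed_field_poly_normal D.
rewrite Ds -mul_polyC; apply: approx_invertibleM.
  by apply: approx_invertibleC; rewrite lead_coef_eq0.
rewrite big_seq; apply: approx_invertible_prod => z zs.
have : root D z by rewrite Ds rootZ ?lead_coef_eq0// root_prod_XsubC.
rewrite /root DE addr_eq0 => /eqP zE.
have /eqP : normc (z + 1) ^+ n = normc (z - 1) ^+ n.
  by rewrite -!normcX zE normcN.
rewrite eqrXn2 ?normc_ge0// => /eqP /(congr1 (fun x => x ^+ 2)).
rewrite sqr_normcD1 sqr_normcB1 => zz.
rewrite (Re0_complexi (z := z)); last by lra.
exact: approx_invertible_subi.
Qed.

(** Since [|w - 1|^2 = |w + 1|^2 - 4 Re w] and [|w + 1| <= M + 1], the squared ratio is at most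
    [1 - 4d / (M + 1)^2 < 1]. *)
Lemma Cayley_small M d (e : R) : 0 < d -> 0 <= M -> 0 < e ->
  exists2 n, (0 < n)%N & forall w, normc w <= M -> d <= complex.Re w ->
    normc ((w - 1) ^+ n) <= e * normc ((w + 1) ^+ n).
Proof.
move=> d0 M0 e0; have M1 : 0 < (M + 1) ^+ 2 by rewrite exprn_gt0// ltr_wpDl.
pose k := Num.max 0 (1 - 4 * d / (M + 1) ^+ 2).
have k0 : 0 <= k by rewrite le_max lexx.
have k1 : k < 1.
  by rewrite gt_max ltr01/= ltrBlDr ltrDl divr_gt0// mulr_gt0.
have [n kn] := exists_expr_le k0 k1 e0.
exists (n.+1 * 2)%N => // w wM dw.
rewrite [in X in X <= _]mulnC [in X in _ <= X]mulnC !exprM !(normcX _ n.+1) !(normcX _ 2).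
have hk : normc (w - 1) ^+ 2 <= k * normc (w + 1) ^+ 2.
  have kE : (M + 1) ^+ 2 - 4 * d <= k * (M + 1) ^+ 2.
    have : 1 - 4 * d / (M + 1) ^+ 2 <= k by rewrite le_max lexx orbT.
    by rewrite -(ler_pM2r M1) mulrBl mul1r divfK// gt_eqF.
  have : normc (w + 1) ^+ 2 <= (M + 1) ^+ 2.
    rewrite lerXn2r ?nnegrE ?normc_ge0 ?addr_ge0//.
    by apply: le_trans (le_normcD _ _) _; rewrite normc1 lerD2r.
  by move: kE; rewrite sqr_normcB1 sqr_normcD1; nra.
apply: le_trans (_ : (k * normc (w + 1) ^+ 2) ^+ n.+1 <= _).
  by rewrite lerXn2r ?nnegrE ?sqr_ge0// mulr_ge0// sqr_ge0.
rewrite exprMn ler_wpM2r ?exprn_ge0 ?normc_ge0//.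
apply: le_trans kn; rewrite exprS ler_piMl ?exprn_ge0//; exact: ltW.
Qed.

Lemma halfplane_separation M d (e : R) : 0 < d -> 0 <= M -> 0 < e ->
  exists h : {poly R[i]}, forall w, normc w <= M ->
    (d <= complex.Re w -> normc (h.[w] - 1) <= e) /\
    (complex.Re w <= - d -> normc h.[w] <= e).
Proof.
move=> d0 M0 e0.
(* With [t <= 1/3] the dominant one of [A x] and [B x] has modulus at most [(1 + t) / (1 - t) <= 2],
   so the final errors are at most [t + 2t] and [2t]. *)
pose t := Num.min 1 e / 3.
have [t0 t1 te] : [/\ 0 < t, 3 * t <= 1 & 3 * t <= e].
  have m0 : 0 < Num.min 1 e by rewrite lt_min e0 ltr01.
  have : Num.min 1 e <= 1 by rewrite ge_min lexx.
  have : Num.min 1 e <= e by rewrite ge_min lexx orbT.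
  by rewrite /t; split; lra.
have [n n0 hn] := Cayley_small d0 M0 t0.
have [b hb] := approx_invertible_Cayley n0 d0 M0 t0.
exists (('X + 1) ^+ n * b) => w wM; rewrite !hornerE.
have := hb w; rewrite !hornerE.
set A := (w + 1) ^+ n; set B := (w - 1) ^+ n; set x := b.[w] => hw.
split=> dw.
  have {}hw : normc (1 - (A + B) * x) <= t.
    by apply: hw; split => //; apply: le_trans dw _; exact: ler_norm.
  have BA : normc (B * x) <= t * normc (A * x).
    by rewrite !normcM mulrA ler_wpM2r ?normc_ge0// hn.
  have E1 : normc (A * x) <= normc (1 - (1 - (A + B) * x)) + normc (B * x).
    by rewrite [A * x](_ : _ = 1 - (1 - (A + B) * x) - B * x) ?ler_normcB//; ring.
  have := ler_normcB 1 (1 - (A + B) * x); rewrite normc1 => E2.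
  have E3 : normc (A * x - 1) <= normc (1 - (A + B) * x) + normc (B * x).
    rewrite -normcN; apply: le_trans (le_normcD _ _).
    by rewrite [X in normc X](_ : _ = 1 - (A + B) * x + B * x)//; ring.
  by have := normc_ge0 (A * x); nra.
have {}hw : normc (1 - (A + B) * x) <= t.
  by apply: hw; split => //; rewrite -normrN; apply: le_trans (ler_norm _); lra.
have AB : normc (A * x) <= t * normc (B * x).
  rewrite !normcM mulrA ler_wpM2r ?normc_ge0//.
  (* The reflection [w -> -w] exchanges [w + 1] and [w - 1] up to sign. *)
  have := hn (- w); rewrite normcN => /(_ wM).
  have -> : - w - 1 = - (w + 1) by rewrite opprD.
  have -> : - w + 1 = - (w - 1) by rewrite opprB addrC.
  rewrite !(normcX _ n) !normcN -!(normcX _ n); apply.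
  by move: dw; case: (w) => ? ? /=; lra.
have E1 : normc (B * x) <= normc (1 - (1 - (A + B) * x)) + normc (A * x).
  by rewrite [B * x](_ : _ = 1 - (1 - (A + B) * x) - A * x) ?ler_normcB//; ring.
have := ler_normcB 1 (1 - (A + B) * x); rewrite normc1 => E2.
by have := normc_ge0 (B * x); nra.
Qed.

End halfplane_separation.

(** * Cauchy's estimate for polynomials *)

Section cauchy_estimate.
Context {R : realType}.
Implicit Types (p : {poly R[i]}) (a z : R[i]).

Lemma complex_prim_root_exists n : (0 < n)%N ->
  exists w : R[i], n.-primitive_root w.
Proof.
move=> n0; pose p : {poly R[i]} := 'X^n - 1.
have [s Dp] := closed_field_poly_normal p.
rewrite (monicP _) ?monicXnsubC // scale1r in Dp.
have sn1 : all n.-unity_root s by apply/allP => z; rewrite -root_prod_XsubC -Dp.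
have sz : (n < (size s).+1)%N by rewrite -(size_prod_XsubC s id) -Dp size_XnsubC.
have [|z _ zn] := hasP (has_prim_root n0 sn1 _ sz); last by exists z.
by rewrite -separable_prod_XsubC -Dp separable_Xn_sub_1 // pnatr_eq0 -lt0n.
Qed.

Lemma normc_prim_root n (w : R[i]) : n.-primitive_root w -> normc w = 1.
Proof.
move=> wn; have n0 := prim_order_gt0 wn.
have := congr1 (@normc R) (prim_expr_order wn).
by rewrite normcX normc1 => /eqP; rewrite pexpr_eq1 ?normc_ge0// => /eqP.
Qed.

Lemma normc_sum (I : Type) (s : seq I) (P : pred I) (F : I -> R[i]) :
  normc (\sum_(i <- s | P i) F i) <= \sum_(i <- s | P i) normc (F i).
Proof.
elim/big_ind2 : _ => //; first by rewrite normc0.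
by move=> x1 x2 y1 y2 ? ?; apply: le_trans (le_normcD _ _) _; rewrite lerD.
Qed.

(* The k-th Taylor coefficient is the k-th discrete Fourier coefficient of the
   values of p at the points a + r w^j, where w is a primitive n-th root of 1
   and n is larger than the degree of p and k. *)
Lemma cauchy_estimate p a (r e : R) k : 0 <= r ->
  (forall z, normc (z - a) <= r -> normc p.[z] <= e) ->
  normc p^`N(k).[a] * r ^+ k <= e.
Proof.
move=> r0 pe; pose n := maxn (size p) k.+1.
have n0 : (0 < n)%N by rewrite leq_max orbT.
have kn : (k < n)%N by rewrite leq_max leqnn orbT.
have [w wn] := complex_prim_root_exists n0.
have w1 := normc_prim_root wn.
(* The exponent [j * (n - k)] stands for [-jk], as [w^n = 1]. *)
have fourier : \sum_(j < n) p.[a + r%:C * w ^+ j] * w ^+ (j * (n - k)) =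
    p^`N(k).[a] * r%:C ^+ k *+ n.
  under eq_bigr => j _.
    rewrite (@nderiv_taylor_wide _ n); first last.
    - by rewrite leq_max leqnn.
    - exact: mulrC.
    rewrite mulr_suml; over.
  (* Only the Taylor term of index [k] survives; the others carry a full geometric sum over an n-th
     root of unity other than 1. *)
  rewrite exchange_big/= (bigD1 (Ordinal kn))//= [X in _ + X]big1 ?addr0.
    rewrite -[n in RHS]card_ord -sumr_const; apply: eq_bigr => j _.
    rewrite exprMn -[RHS]mulr1 -!mulrA; congr (_ * (_ * _)).
    rewrite -exprM -exprD -mulnDr subnKC 1?ltnW// mulnC exprM.
    by rewrite (prim_expr_order wn) expr1n.
  move=> i ik.
  under eq_bigr => j _.
    rewrite exprMn -!mulrA -exprM -exprD -mulnDr [(j * _)%N]mulnC exprM mulrA; over.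
  rewrite -mulr_sumr; set y := w ^+ _.
  suff -> : \sum_(j < n) y ^+ j = 0 by rewrite mulr0.
  have y1 : y - 1 != 0.
    rewrite subr_eq0 /y -(prim_order_dvd wn); apply: contra ik => nik.
    rewrite -val_eqE/= -(modn_small (ltn_ord i)) -(modn_small kn).
    by rewrite -(eqn_modDr (n - k)) subnKC 1?ltnW// modnn.
  apply: (mulfI y1); rewrite mulr0 -subrX1.
  by rewrite /y -exprM mulnC exprM (prim_expr_order wn) expr1n subrr.
have n0' : 0 < n%:R :> R by rewrite ltr0n.
rewrite -(ler_pM2l n0').
have -> : n%:R * (normc p^`N(k).[a] * r ^+ k) = normc (p^`N(k).[a] * r%:C ^+ k *+ n).
  by rewrite normcMn normcM normcX normc_real ger0_norm// mulr_natl.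
rewrite -fourier; apply: le_trans (normc_sum _ _ _) _.
apply: (@le_trans _ _ (\sum_(j < n) e)); last by rewrite sumr_const card_ord mulr_natl.
apply: ler_sum => j _; rewrite normcM !normcX w1 expr1n mulr1.
by apply: pe; rewrite addrC addKr normcM normcX w1 expr1n mulr1 normc_real ger0_norm.
Qed.

Lemma cauchy_estimate_derivn p a (r e : R) k : 0 < r ->
  (forall z, normc (z - a) <= r -> normc p.[z] <= e) ->
  normc p^`(k).[a] <= k`!%:R * e / r ^+ k.
Proof.
move=> r0 pe; rewrite ler_pdivlMr ?exprn_gt0//.
rewrite nderivn_def hornerMn normcMn -[X in X * _]mulr_natl -mulrA.
by rewrite ler_wpM2l ?ler0n// cauchy_estimate// ltW.
Qed.

End cauchy_estimate.

(** * Compactness and countability arguments *)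

Section compact_sets.
Context {R : realType}.
Implicit Types (K : set R[i]) (a z : R[i]).

Lemma nbhs_normc a (e : R) : 0 < e -> \forall z \near a, normc (z - a) < e.
Proof.
move=> e0; have e0' : 0 < e%:C by rewrite ltcR.
have := nbhsx_ballx a _ e0'; apply: filterS => z.
by rewrite -ball_normE/= -normcN opprB -ltcR.
Qed.

Lemma compact_normc_bounded K : compact K ->
  exists2 M : R, 0 <= M & forall a, K a -> normc a <= M.
Proof.
move=> cK.
have cN : {within K, continuous (@normc R : R[i] -> R)}.
  by apply: continuous_subspaceT; exact: normc_continuous.
have /compact_bounded[M [_ HM]] := continuous_compact cN cK.
exists (`|M| + 1) => [|a Ka]; first by rewrite addr_ge0.
apply: le_trans (ler_norm _) _; apply: HM; last by exists a.
by rewrite (le_lt_trans (ler_norm M))// ltrDl.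
Qed.

(** Compactness in its near-covering form, along the filter of positive radii tending to 0. *)
Lemma compact_uniform_radius K (P : R -> R[i] -> Prop) : compact K ->
  (forall d d' a, d' <= d -> P d a -> P d' a) ->
  (forall a0, K a0 -> exists2 d, 0 < d & forall a, normc (a - a0) < d -> P d a) ->
  exists2 d, 0 < d & forall a, K a -> P d a.
Proof.
move=> cK Pmono Ploc.
have : \forall d \near (0 : R)^'+, K `<=` P d.
  apply: (iffLR (compact_near_coveringP K)) => // a0 Ka0.
  have [d d0 dP] := Ploc a0 Ka0.
  exists ([set a | normc (a - a0) < d], [set d' | d' < d]) => /=.
    by split; [exact: nbhs_normc|exact: nbhs_right_lt].
  by move=> [a d'] /= [ad /ltW d'd]; apply: Pmono d'd _; exact: dP.
move=> KP; have [d [d0 dP]] := filter_ex (filterI (@nbhs_right_gt R 0) KP).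
by exists d.
Qed.

(** A countable set has Lebesgue measure 0, the interval has measure [y - x > 0]. *)
Lemma countable_itv_avoid (S : set R) (x y : R) : countable S -> x < y ->
  exists c, [/\ x <= c, c <= y & ~ S c].
Proof.
move=> cS xy; apply: contrapT => noc.
have sub : `[x, y]%classic `<=` S.
  move=> c; rewrite /= in_itv/= => /andP[xc cy].
  by apply: contrapT => Sc; apply: noc; exists c.
have := countable_lebesgue_measure0 (sub_countable (subset_card_le sub) cS).
rewrite lebesgue_measure_itv/= lte_fin xy => /eqP.
by rewrite -EFinB eqe subr_eq0 gt_eqF.
Qed.

End compact_sets.

(** * Gluing local polynomial models *)

Section gluing.
Context {R : realType} (K : set R[i]) (J : R[i] -> {poly R[i]} -> Prop).
Implicit Types (T : set R[i]) (a u z : R[i]) (c d : R).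

(* J a p means that p is an acceptable local model at a; the radius r does not
   depend on the accuracy, so that derivatives can be estimated at a. *)
Definition locally_modelled T := exists2 r : R, 0 < r &
  forall e : R, 0 < e -> exists F : {poly R[i]}, forall a, K a -> T a ->
    exists2 p, J a p & forall z, normc (z - a) <= r -> normc (F.[z] - p.[z]) <= e.

Lemma locally_modelled_sub T' T : (forall a, K a -> T a -> T' a) ->
  locally_modelled T' -> locally_modelled T.
Proof.
move=> TT' [r r0 H]; exists r => // e e0; have [F HF] := H e e0.
by exists F => a Ka Ta; apply: HF => //; exact: TT'.
Qed.

Lemma locally_modelled_common p T : (forall a, K a -> T a -> J a p) ->
  locally_modelled T.
Proof.
move=> Jp; exists 1 => // e e0; exists p => a Ka Ta; exists p; first exact: Jp.
by move=> z _; rewrite subrr normc0 ltW.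
Qed.

Lemma poly_normc_bounded (p : {poly R[i]}) (M : R) : 0 <= M ->
  exists2 B : R, 0 <= B & forall z, normc z <= M -> normc p.[z] <= B.
Proof.
move=> M0; elim/poly_ind: p => [|p x [B B0 HB]].
  by exists 0 => // z _; rewrite horner0 normc0.
exists (B * M + normc x) => [|z zM]; first by rewrite addr_ge0 ?mulr_ge0 ?normc_ge0.
rewrite !hornerE; apply: le_trans (le_normcD _ _) _; rewrite lerD2r normcM.
by rewrite ler_pM ?normc_ge0// HB.
Qed.

Lemma locally_modelledU u c d T1 T2 : compact K -> normc u = 1 -> 0 < d ->
  (forall a, K a -> T1 a -> complex.Re (u * a) <= c - d) ->
  (forall a, K a -> T2 a -> c + d <= complex.Re (u * a)) ->
  locally_modelled T1 -> locally_modelled T2 -> locally_modelled (T1 `|` T2).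
Proof.
move=> cK u1 d0 sep1 sep2 [r1 r10 H1] [r2 r20 H2].
have [M M0 KM] := compact_normc_bounded cK.
(* Discs of radius [r] about the points of the two pieces stay at distance [d / 2] from the line and
   inside the disc of radius [M + 1]. *)
pose r := Num.min 1 (Num.min (d / 2) (Num.min r1 r2)).
have [r0 rle1 rd rr1 rr2] : [/\ 0 < r, r <= 1, r <= d / 2, r <= r1 & r <= r2].
  by split; rewrite /r ?lt_min ?ge_min ?lexx ?ltr01 ?divr_gt0 ?r10 ?r20 ?orbT.
exists r => // e e0; have e20 : 0 < e / 2 by lra.
have [F1 {}H1] := H1 _ e20; have [F2 {}H2] := H2 _ e20.
have M10 : 0 <= M + 1 by lra.
(* [B] depends on [e], but [r] is already fixed; the separating polynomial, chosen last, is accurate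
   enough to absorb [B]. *)
have [B B0 HB] := poly_normc_bounded (F2 - F1) M10.
pose t := e / (2 * (B + 1)).
have t0 : 0 < t by rewrite divr_gt0// mulr_gt0// ltr_wpDl.
have tB : t * B <= e / 2.
  have -> : e / 2 = t * (B + 1) by rewrite /t; field; lra.
  by rewrite ler_wpM2l//; [exact: ltW|lra].
have d20 : 0 < d / 2 by lra.
have Mc0 : 0 <= M + 1 + `|c| by rewrite addr_ge0.
have [h hP] := halfplane_separation d20 Mc0 t0.
(* This rigid motion carries the separating line to the imaginary axis. *)
pose q := u *: 'X - (c%:C)%:P.
have qE z : q.[z] = u * z - c%:C by rewrite /q !hornerE.
exists (F1 + (h \Po q) * (F2 - F1)) => a Ka Ta.
have nz z : normc (z - a) <= r -> normc z <= M + 1.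
  move=> za; rewrite -(subrK a z); apply: le_trans (le_normcD _ _) _.
  by have := KM a Ka; lra.
have qM z : normc (z - a) <= r -> normc q.[z] <= M + 1 + `|c|.
  move=> za; rewrite qE; apply: le_trans (ler_normcB _ _) _.
  by rewrite normcM u1 mul1r normc_real lerD2r nz.
have qRe z : normc (z - a) <= r ->
    complex.Re (u * a) - c - d / 2 <= complex.Re q.[z] <=
    complex.Re (u * a) - c + d / 2.
  move=> za.
  have -> : complex.Re q.[z] =
      complex.Re (u * a) - c + complex.Re (u * (z - a)).
    by rewrite qE; case: (u) (z) (a) => [? ?] [? ?] [? ?] /=; ring.
  have := ler_Re_normc (u * (z - a)); rewrite normcM u1 mul1r ler_norml => /andP[].
  by move=> ? ?; apply/andP; split; lra.
case: Ta => Ta.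
  have [p Jp pF] := H1 a Ka Ta; exists p => // z za.
  rewrite hornerD hornerM horner_comp.
  rewrite (_ : F1.[z] + _ - _ =
    (F1.[z] - p.[z]) + h.[q.[z]] * (F2 - F1).[z]); last by ring.
  apply: le_trans (le_normcD _ _) _; rewrite normcM.
  have h1 : normc (F1.[z] - p.[z]) <= e / 2 by apply: pF; exact: le_trans rr1.
  have h2 : normc h.[q.[z]] <= t.
    apply: (hP _ (qM z za)).2.
    by have := qRe z za; have := sep1 a Ka Ta => ? /andP[]; lra.
  have h3 : normc (F2 - F1).[z] <= B by exact/HB/nz.
  have : normc h.[q.[z]] * normc (F2 - F1).[z] <= t * B by rewrite ler_pM ?normc_ge0.
  lra.
have [p Jp pF] := H2 a Ka Ta; exists p => // z za.
rewrite hornerD hornerM horner_comp.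
rewrite (_ : F1.[z] + _ - _ =
  (F2.[z] - p.[z]) + (h.[q.[z]] - 1) * (F2 - F1).[z]); last first.
  by rewrite hornerD hornerN; ring.
apply: le_trans (le_normcD _ _) _; rewrite normcM.
have h1 : normc (F2.[z] - p.[z]) <= e / 2 by apply: pF; exact: le_trans rr2.
have h2 : normc (h.[q.[z]] - 1) <= t.
  apply: (hP _ (qM z za)).1.
  by have := qRe z za; have := sep2 a Ka Ta => ? /andP[]; lra.
have h3 : normc (F2 - F1).[z] <= B by exact/HB/nz.
have : normc (h.[q.[z]] - 1) * normc (F2 - F1).[z] <= t * B by rewrite ler_pM ?normc_ge0.
lra.
Qed.

Hypotheses (cK : compact K) (countK : countable K).

(** The projection of [K] to the direction [u] is countable, so it misses some [c]; compactness
    makes the gap around [c] uniform. *)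
Lemma exists_separating_line u (x y : R) : normc u = 1 -> x < y ->
  exists c, [/\ x <= c, c <= y &
    exists2 d, 0 < d & forall a, K a -> d <= `|complex.Re (u * a) - c|].
Proof.
move=> u1 xy.
have cRe : countable ((fun a => complex.Re (u * a)) @` K).
  exact: sub_countable (card_image_le _ _) countK.
have [c [xc cy Kc]] := countable_itv_avoid cRe xy.
exists c; split => //; apply: compact_uniform_radius => // [d d' a dd'|a0 Ka0].
  exact: le_trans.
pose m := `|complex.Re (u * a0) - c|.
have m0 : 0 < m.
  by rewrite normr_gt0 subr_eq0; apply/eqP => E; apply: Kc; exists a0.
exists (m / 2) => [|a aa0]; first by rewrite divr_gt0.
have : `|complex.Re (u * (a - a0))| <= normc (a - a0).
  by apply: le_trans (ler_Re_normc _) _; rewrite normcM u1 mul1r.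
have -> : complex.Re (u * (a - a0)) =
    (complex.Re (u * a) - c) - (complex.Re (u * a0) - c).
  by case: (u) (a) (a0) => [? ?] [? ?] [? ?] /=; ring.
have := ler_normB (complex.Re (u * a) - c)
  ((complex.Re (u * a) - c) - (complex.Re (u * a0) - c)).
rewrite subKr -/m; lra.
Qed.

(** Sweeping across [K] from [-M] to [M], each gluing extends the modelled part by [rho / 2]. *)
Lemma locally_modelled_strips u (rho : R) T : normc u = 1 -> 0 < rho ->
  (forall x, locally_modelled
    (T `&` [set z | x <= complex.Re (u * z) <= x + rho])) ->
  locally_modelled T.
Proof.
move=> u1 rho0 strip.
have [M M0 KM] := compact_normc_bounded cK.
have KRe a : K a -> - M <= complex.Re (u * a) <= M.
  move=> Ka; rewrite -ler_norml; apply: le_trans (ler_Re_normc _) _.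
  by rewrite normcM u1 mul1r KM.
suff claim (n : nat) : locally_modelled
    (T `&` [set z | complex.Re (u * z) <= - M + n%:R * (rho / 2)]).
  have [n hn] : exists n : nat, 2 * M <= n%:R * (rho / 2).
    exists (Num.bound `|2 * M / (rho / 2)|).
    rewrite -ler_pdivrMr ?divr_gt0//; apply: le_trans (ler_norm _) _.
    by apply/ltW; apply: archi_boundP.
  apply: locally_modelled_sub (claim n) => a Ka Ta; split => //=.
  by have /andP[] := KRe a Ka; lra.
elim: n => [|n ih].
  apply: locally_modelled_sub (strip (- M)) => a Ka [Ta /= aM]; split => //=.
  by have /andP[-> _] := KRe a Ka; move: aM; lra.
pose x := - M + n%:R * (rho / 2).
have xlt : x - rho / 2 < x by lra.
(* As [x - rho / 2 <= c <= x], the part left of [c] is already modelled, and the strip of width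
   [rho] from [c] reaches [x + rho / 2]. *)
have [c [xc cx [d d0 cd]]] := exists_separating_line u1 xlt.
have H1 : locally_modelled (T `&` [set z | complex.Re (u * z) <= c - d]).
  by apply: locally_modelled_sub ih => a Ka [Ta /= ac]; split => //=; rewrite -/x; lra.
have H2 : locally_modelled (T `&` [set z | c + d <= complex.Re (u * z) <= c + rho]).
  apply: locally_modelled_sub (strip c) => a Ka [Ta /= /andP[? ?]]; split => //=.
  by apply/andP; split; lra.
have := @locally_modelledU u c d _ _ cK u1 d0 _ _ H1 H2.
move=> /(_ (fun a _ => @proj2 _ _))/(_ (fun a _ H => proj1 (andP H.2))).
apply: locally_modelled_sub => a Ka [Ta /=]; rewrite -natr1 mulrDl mul1r addrA -/x => ax.
have := cd a Ka; rewrite ler_normr => /orP[ad|ad]; [right|left]; split => //=; last lra.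
by apply/andP; split; lra.
Qed.

Lemma locally_modelled_countable :
  (forall a0, K a0 -> exists2 rho : R, 0 < rho &
    exists p, forall a, K a -> normc (a - a0) < rho -> J a p) ->
  locally_modelled setT.
Proof.
move=> Jloc.
have [rho rho0 Hrho] : exists2 rho : R, 0 < rho & forall a0, K a0 ->
    exists p, forall a, K a -> normc (a - a0) < rho -> J a p.
  apply: compact_uniform_radius => // [d d' a dd' [p pJ]|a0 Ka0].
    by exists p => b Kb bd; apply: pJ => //; exact: lt_le_trans dd'.
  have [r r0 [p pJ]] := Jloc a0 Ka0; exists (r / 2) => [|a ad]; first by rewrite divr_gt0.
  exists p => b Kb bd; apply: pJ => //; rewrite -(subrK a b) -addrA.
  by apply: le_lt_trans (le_normcD _ _) _; lra.
(* Strips in the directions 1 and [-i] cut out squares of side [rho / 3]; two points of a square are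
   at distance at most [2 rho / 3 < rho]. *)
have rho30 : 0 < rho / 3 by lra.
apply: (@locally_modelled_strips 1 _ _ _ rho30); first exact: normc1.
move=> x; apply: (@locally_modelled_strips (- 'i%C) _ _ _ rho30).
  by rewrite normcN normc_i.
move=> y; set T := (X in locally_modelled X).
have [[a0 [Ka0 Ta0]]|empty] := pselect (exists a, K a /\ T a); last first.
  by apply: (locally_modelled_common (p := 0)) => a Ka Ta; case: empty; exists a.
have [p pJ] := Hrho a0 Ka0; apply: (locally_modelled_common (p := p)) => a Ka Ta.
apply: pJ => //; move: Ta Ta0; rewrite /T /=.
case: a Ka => a1 a2 Ka; case: a0 Ka0 => b1 b2 Kb /=.
move=> [[_ /andP[h1 h2]] /andP[h3 h4]] [[_ /andP[h5 h6]] /andP[h7 h8]].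
apply: (@le_lt_trans _ _ (`|a1 - b1| + `|a2 - b2|)).
  exact: (ler_normc_ReIm (Complex (a1 - b1) (a2 - b2))).
have : `|a1 - b1| <= rho / 3 by rewrite ler_norml; apply/andP; split; lra.
have : `|a2 - b2| <= rho / 3 by rewrite ler_norml; apply/andP; split; lra.
lra.
Qed.

End gluing.

(** * Polynomials with a prescribed jet at a point *)

Section hermite_interpolation.
Context {F : fieldType}.

Lemma derivn_comp_subX (p : {poly F}) (a : F) k :
  (p \Po ('X - a%:P))^`(k) = p^`(k) \Po ('X - a%:P).
Proof.
elim: k => [|k ih]; first by rewrite !derivn0.
by rewrite !derivnS ih deriv_comp derivB derivX derivC subr0 mulr1.
Qed.

Lemma exists_poly_jet (a : F) (c : nat -> F) N : [pchar F] =i pred0 ->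
  exists p : {poly F}, forall k, (k <= N)%N -> p^`(k).[a] = c k.
Proof.
move=> char0; pose q := \poly_(k < N.+1) (c k / k`!%:R).
exists (q \Po ('X - a%:P)) => k kN.
rewrite derivn_comp_subX horner_comp !hornerE subrr horner_coef0 coef_derivn.
rewrite addn0 ffactnn coef_poly ltnS kN -[LHS]mulr_natr divfK//.
by rewrite (iffLR (pcharf0P _) char0) -lt0n fact_gt0.
Qed.

End hermite_interpolation.

(** * Uniform approximation of finitely many functions by one jet *)

Section jet_approximation.
Context {R : realType} (K : set R[i]).

(** Serves both for the radii of neighbourhoods and for the accuracies required by Cauchy's estimate
    at the orders up to [N]. *)
Lemma common_radius (Q : nat -> R -> Prop) N :
  (forall k d d', 0 < d' -> d' <= d -> Q k d -> Q k d') ->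
  (forall k, (k <= N)%N -> exists2 d, 0 < d & Q k d) ->
  exists2 d, 0 < d & forall k, (k <= N)%N -> Q k d.
Proof.
move=> Qmono; elim: N => [|N ih] QN.
  have [d d0 Qd] := QN 0 (leqnn _).
  by exists d => // k; rewrite leqn0 => /eqP ->.
have [k kN|d1 d10 Q1] := ih; first exact/QN/leqW.
have [d2 d20 Q2] := QN _ (leqnn _).
have m0 : 0 < Num.min d1 d2 by rewrite lt_min d10.
exists (Num.min d1 d2) => // k; rewrite leq_eqVlt => /orP[/eqP ->|kN].
  by apply: Qmono Q2 => //; rewrite ge_min lexx orbT.
by apply: Qmono (Q1 k kN) => //; rewrite ge_min lexx.
Qed.

Lemma nbhs_normcP (a : R[i]) (A : set R[i]) : nbhs a A ->
  exists2 d : R, 0 < d & forall z, normc (z - a) < d -> A z.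
Proof.
(* The radius [e] is a positive element of [R[i]], hence real. *)
move=> /nbhs_ballP[e /= e0 aA]; exists (complex.Re e).
  by move: e0; rewrite ltcE => /andP[].
move=> z za; apply: aA; rewrite -ball_normE/= -normrN opprB.
by rewrite -[e](RRe_real (gtr0_real e0)) [X in X < _](_ : _ = (normc (z - a))%:C)// ltcR.
Qed.

Lemma CK_locally_close (f : K -> R[i]) (p : {poly R[i]}) (a0 : K) (e : R) :
  CK K f -> p.[\val a0] = f a0 -> 0 < e ->
  exists2 d : R, 0 < d & forall a : K, normc (\val a - \val a0) < d ->
    normc (p.[\val a] - f a) <= e.
Proof.
move=> cf pa0 e0.
pose G := valL_ (0 : R[i]) f.
have sG : sigL K G = f by exact: valLK.
have cG : {within K, continuous (fun z => p.[z] - G z)}.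
  move=> z; apply: continuousB.
    by apply: continuous_subspaceT => {}z; exact: continuous_hornerC.
  move: z; apply/(@subspace_sigL_continuousP R[i] K R[i] G).
  by rewrite [X in continuous X]sG.
have Ka0 : K (\val a0) by exact: set_valP.
have e0' : 0 < e%:C by rewrite ltcR.
have := cG (\val a0).
move/(@cvgrPdist_le _ _ _ _)/(_ _ e0').
rewrite -[X in X -> _]/(nbhs_subspace _ _) -nbhs_subspace_in//.
move=> /nbhs_normcP[d d0 dK]; exists d => // a ad.
have := dK _ ad (set_valP a).
have GE b : G (\val b) = f b by rewrite -sG.
rewrite /from_subspace (GE a : G (\val a) = _) (GE a0 : G (\val a0) = _).
rewrite pa0 subrr sub0r normrN.
by rewrite [X in X <= _](_ : _ = (normc (p.[\val a] - f a))%:C)// lecR.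
Qed.

Lemma jet_approximation (g : nat -> K -> R[i]) N (e : R) : compact K ->
  countable K -> (forall k, CK K (g k)) -> 0 < e ->
  exists p : {poly R[i]}, forall k, (k <= N)%N -> forall a : K,
    normc (jet K (horner p) k a - g k a) <= e.
Proof.
move=> cK countK cg e0; have e20 : 0 < e / 2 by lra.
pose J a (p : {poly R[i]}) := forall k, (k <= N)%N -> forall b : K, \val b = a ->
  normc (p^`(k).[a] - g k b) <= e / 2.
have [r r0 Hr] : locally_modelled K J setT.
  apply: locally_modelled_countable => // a0 Ka0.
  pose b0 : K := SigSub (mem_set Ka0).
  have [p pE] := @exists_poly_jet _ a0 (fun k => g k b0) N (@pchar_num _).
  have [k d d' _ dd' Q a|k kN|d d0 dP] :=
    @common_radius (fun k d => forall a : K, normc (\val a - a0) < d ->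
      normc (p^`(k).[\val a] - g k a) <= e / 2) N.
  - by move=> ad'; apply: Q; exact: lt_le_trans dd'.
  - exact: (@CK_locally_close _ _ b0 _ (cg k) (pE k kN) e20).
  exists d => //; exists p => a Ka ad k kN b ba; rewrite -ba; apply: dP => //.
  by rewrite ba.
(* The accuracy [n] is chosen after [r], so that Cauchy's estimate on discs of radius [r] bounds the
   derivatives of [F - p] by [e / 2]. *)
have [k d d' d'0 dd' dle|k _|n n0 nP] :=
    @common_radius (fun k d => k`!%:R * d / r ^+ k <= e / 2) N.
- apply: le_trans dle; rewrite ler_wpM2r ?invr_ge0 ?exprn_ge0 ?(ltW r0)//.
  by rewrite ler_wpM2l// ler0n.
- exists (e / 2 * r ^+ k / k`!%:R).
    by rewrite divr_gt0 ?mulr_gt0 ?exprn_gt0// ltr0n fact_gt0.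
  rewrite [X in X / _]mulrC divfK ?mulfK//.
  by rewrite gt_eqF// exprn_gt0.
have [F HF] := Hr n n0.
exists F => k kN a; rewrite /jet derive1n_horner /sigL/=.
have [p pJ pF] := HF (\val a) (set_valP a) I.
have -> : F^`(k).[\val a] - g k a =
    (F - p)^`(k).[\val a] + (p^`(k).[\val a] - g k a).
  by rewrite derivnB hornerD hornerN; ring.
apply: le_trans (le_normcD _ _) _.
have h1 : normc (F - p)^`(k).[\val a] <= e / 2.
  apply: le_trans (nP k kN); apply: cauchy_estimate_derivn => // z za.
  by rewrite hornerD hornerN; exact: pF.
have h2 : normc (p^`(k).[\val a] - g k a) <= e / 2 by exact: pJ.
lra.
Qed.

(** The condition [0 <= e] covers empty [K], where [supdist] is 0. *)
Lemma supdist_le (f g : K -> R[i]) (e : R) : 0 <= e ->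
  (forall a, normc (f a - g a) <= e) -> supdist f g <= e.
Proof.
move=> e0 fg; rewrite /supdist; set E := (X in sup X).
have [hE|hE] := pselect (has_sup E); last by rewrite sup_out.
by apply: ge_sup; [exact: hE.1|move=> _ [z _ <-]; exact: fg].
Qed.

End jet_approximation.

(** * The space B(K) and the density of polynomials for countable K *)

Section countable_compact.
Context {R : realType} (K : set R[i]).

(** A horizontal segment inside [K] would project onto an interval of the countable set of real
    parts. *)
Lemma interior_countable : countable K -> K^° = set0.
Proof.
move=> countK; apply/seteqP; split => // z /nbhs_normcP[d d0 dK].
have cRe : countable (@complex.Re R @` K).
  exact: sub_countable (card_image_le _ _) countK.
have zd : complex.Re z < complex.Re z + d / 2 by rewrite ltrDl divr_gt0.
have [c [zc cz]] := countable_itv_avoid cRe zd; apply.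
exists (z + (c - complex.Re z)%:C); last by case: (z) => x y /=; ring.
by apply: dK; rewrite addrC addKr normc_real ger0_norm; lra.
Qed.

Lemma AK_countable : countable K -> AK K = CK K.
Proof.
move=> countK; apply/seteqP; split => [f []//|f cf]; split => //.
exists (valL_ (0 : R[i]) f); first exact: valLK.
by rewrite interior_countable.
Qed.

Lemma BK_countable : compact K -> countable K ->
  BK K = [set g | forall k : nat, CK K (g k)].
Proof.
move=> cK countK; apply/seteqP; split => [g|g cg]; first exact: BK_CK.
split=> [k|]; first by rewrite AK_countable//; exact: cg.
(* Diagonal choice: the n-th polynomial handles the orders up to [n] with error [1 / (n + 1)], so
   each order is controlled from some [n] on. *)
have [f fP] : {f : nat -> {poly R[i]} & forall n k, (k <= n)%N -> forall a : K,
    normc (jet K (horner (f n)) k a - g k a) <= harmonic n}.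
  apply: (@choice _ _ (fun n p => forall k, (k <= n)%N -> forall a : K,
    normc (jet K (horner p) k a - g k a) <= harmonic n)) => n.
  by apply: jet_approximation => //; exact: harmonic_gt0.
exists (fun n => horner (f n)) => [n|k]; first exact: OK_horner.
apply: (@squeeze_cvgr _ _ _ _ (cst 0) harmonic); last 2 first.
- exact: cvg_cst.
- exact: cvg_harmonic.
exists k => // n /= kn; rewrite supdist_ge0/=.
by apply: supdist_le; [exact: harmonic_ge0|exact: fP].
Qed.

(* The terms of index > N contribute at most 2^-N. *)
Lemma BKdist_le (g h : nat -> K -> R[i]) N (e : R) : 0 <= e ->
  (forall k, (k <= N)%N -> supdist (g k) (h k) <= e) ->
  BKdist g h <= 2 * e + 2^-1 ^+ N.
Proof.
move=> e0 gh.
(* Terms up to [N] are at most [2^-k e], later ones at most [2^-k]; the right-hand side sums these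
   geometric bounds. *)
have partial n : series (BKterm g h) n <= 2 * e * (1 - 2^-1 ^+ n) +
    (if (n <= N)%N then 0 else 2 * (2^-1 ^+ N.+1 - 2^-1 ^+ n)).
  elim: n => [|n ih]; first by rewrite /series/= big_geq// expr0 subrr mulr0 addr0.
  have x0 : 0 < 2^-1 ^+ n :> R by rewrite exprn_gt0// invr_gt0.
  have [s0 s1 se] : [/\ 0 <= BKterm g h n, BKterm g h n <= 2^-1 ^+ n &
      (n <= N)%N -> BKterm g h n <= 2^-1 ^+ n * e].
    have s0 := supdist_ge0 (g n) (h n).
    have s1 : 0 < 1 + supdist (g n) (h n) by rewrite ltr_wpDr.
    split; first exact: BKterm_ge0.
    - rewrite /BKterm div1r -exprVn.
      by rewrite ler_piMr ?(ltW x0)// ler_pdivrMr// mul1r lerDr.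
    - rewrite /BKterm div1r -exprVn => nN; rewrite ler_pM2l//; apply: le_trans (gh n nN).
      by rewrite ler_pdivrMr// mulrDr mulr1 lerDl mulr_ge0.
  rewrite seriesSr exprS; move: ih.
  have [nN|nN|nN] := ltngtP n N.
  - by have := se (ltnW nN); lra.
  - by have := mulr_ge0 e0 (ltW x0); lra.
  - have := se; rewrite nN leqnn exprS -nN => /(_ isT).
    by have := mulr_ge0 e0 (ltW x0); lra.
rewrite BKdistE; apply: limr_le; first exact: BKterm_cvg.
exists N.+1 => // n /= Nn; apply: le_trans (partial n) _.
have x0 : 0 < 2^-1 ^+ n :> R by rewrite exprn_gt0// invr_gt0.
rewrite leqNgt Nn/= exprS.
by have := mulr_ge0 e0 (ltW x0); lra.
Qed.

Lemma dense_Bpolys (cK : compact K) : countable K ->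
  closure (Bpolys cK) = [set: Bspace cK].
Proof.
move=> countK; apply/seteqP; split => // g _ A /nbhs_ballP[e /= e0].
rewrite ballEmdist => gA.
have cg k : CK K (set_val g k) by apply: BK_CK; exact: set_valP.
(* The distance will be at most [2 (e / 4) + e / 4 < e]. *)
have e40 : 0 < e / 4 by lra.
have half1 : 2^-1 < 1 :> R by rewrite invf_lt1// ltr1n.
have half0 : 0 <= 2^-1 :> R by rewrite invr_ge0.
have [N Ne] := exists_expr_le half0 half1 e40.
have [p pg] := jet_approximation N cK countK cg e40.
exists (Bpoly cK p); split; first by exists p.
apply: gA; rewrite /= -[mdist _ _]/(BKdist _ _) BKdist_sym.
have : BKdist (jet K (horner p)) (set_val g) <= 2 * (e / 4) + 2^-1 ^+ N.
  apply: BKdist_le => [|k kN]; first exact: ltW.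
  by apply: supdist_le; [exact: ltW|exact: pg].
by move=> pgle; apply: le_lt_trans pgle _; lra.
Qed.

End countable_compact.

Theorem mainTheorem2 (R : realType) (K : set R[i]) (cK : compact K)
    (countK : countable K) :
  closure (Bpolys cK) = [set: Bspace cK] /\
  BK K = [set g | forall k : nat, CK K (g k)].
Proof.
split; first exact: dense_Bpolys.
exact: BK_countable.
Qed.
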